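(* Let $n\ge 1$ and $m\ge 2$. Let $\operatorname{Dist}(D_n,m)$ be the polytope of tuples $p=(p_{\tau_1},\dots,p_{\tau_n})$ of $m\times m$ real matrices with nonnegative entries $p_{\tau_i}^{ab}$ ($a,b\in\{0,\dots,m-1\}$), each with total sum $1$, such that all matrices $p_{\tau_i}$ have the same vector of row sums and the same vector of column sums. Then the assignment $$p\longmapsto (A_1,\dots,A_n),\qquad A_i=\{(e_a,e_b)^T:\ p_{\tau_i}^{ab}\neq 0\},$$ is a one-to-one correspondence between the vertices of $\operatorname{Dist}(D_n,m)$ and the collections $A_1,\dots,A_n$ of sets of product-simplex vertices in $\mathbb{R}^{2m}$ satisfying: (1) for every $1\le i\le n$, the set $A_i$ is affinely independent; (2) the intersection $\bigcap_{i=1}^n\operatorname{Conv}(A_i)$ consists of a single point $u$, and for every $1\le i\le n$ the unique affine representation $u=\sum_{x\in A_i}\alpha_x x$ has $\alpha_x\neq 0$ for all $x\in A_i$.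
   Context: $D_n$ is the dipole graph: two nodes $s,t$ and $n$ directed edges $\tau_1,\dots,\tau_n$, each from $s$ to $t$. A distribution on it with outcomes in $\{0,\dots,m-1\}$ assigns to each edge a probability matrix $p_{\tau_i}$ such that the row sums of $p_{\tau_i}$ give a common probability vector at $s$ and the column sums give a common probability vector at $t$; this is the polytope $\operatorname{Dist}(D_n,m)$ described in the claim. $e_0,\dots,e_{m-1}$ are the standard basis vectors of $\mathbb{R}^m$; a product-simplex vertex in $\mathbb{R}^{2m}$ is a vector $(e_a,e_b)^T\in\mathbb{R}^{2m}$ obtained by stacking $e_a$ on top of $e_b$. $\operatorname{Conv}$ denotes convex hull. *)

(* Defs.v *)
From HB Require Import structures.
From mathcomp Require Import all_boot all_order all_algebra finmap.
From mathcomp Require Import boolp classical_sets functions reals.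

Set Implicit Arguments.
Unset Strict Implicit.
Unset Printing Implicit Defensive.

Import Order.TTheory GRing.Theory Num.Theory.
Local Open Scope classical_set_scope.
Local Open Scope ring_scope.

Section ConvexGeometry.
Variables (R : realType) (V : lmodType R).
Implicit Types (A : {fset V}) (K : set V) (alpha : V -> R) (u : V).

(* Only the values of [alpha] on [A] matter. *)
Definition affine_representation A alpha u :=
  \sum_(x <- A) alpha x = 1 /\ \sum_(x <- A) alpha x *: x = u.

Definition affinely_independent A :=
  forall alpha, \sum_(x <- A) alpha x = 0 -> \sum_(x <- A) alpha x *: x = 0 ->
  {in A, forall x, alpha x = 0}.

Definition Conv A : set V :=
  [set u | exists alpha,
     {in A, forall x, 0 <= alpha x} /\ affine_representation A alpha u].

(* The vertices of a polytope, i.e. its extreme points. *)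
Definition vertices K : set V :=
  [set p | K p /\ forall q r (t : R), K q -> K r -> 0 < t < 1 ->
     p = t *: q + (1 - t) *: r -> q = p /\ r = p].

End ConvexGeometry.

Section Dipole.
Variables (R : realType) (n m : nat).

Definition Dist : set {ffun 'I_n -> 'M[R]_m} :=
  [set p : {ffun 'I_n -> 'M[R]_m} |
    [/\ forall i a b, 0 <= p i a b,
        forall i, \sum_a \sum_b p i a b = 1,
        forall i j a, \sum_b p i a b = \sum_b p j a b
      & forall i j b, \sum_a p i a b = \sum_a p j a b]].

(* (e_a, e_b)^T, with R^(2m) as 'cV[R]_(m + m). *)
Definition simplex_vertex (a b : 'I_m) : 'cV[R]_(m + m) :=
  col_mx (delta_mx a 0) (delta_mx b 0).

Definition vertex_supports (p : {ffun 'I_n -> 'M[R]_m}) :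
    {ffun 'I_n -> {fset 'cV[R]_(m + m)}} :=
  [ffun i => [fset simplex_vertex ab.1 ab.2 |
                ab in [pred ab : 'I_m * 'I_m | p i ab.1 ab.2 != 0]]%fset].

Definition admissible_collections :
    set {ffun 'I_n -> {fset 'cV[R]_(m + m)}} :=
  [set A : {ffun 'I_n -> {fset 'cV[R]_(m + m)}} |
    [/\ forall i x, x \in A i -> exists a b, x = simplex_vertex a b,
        forall i, affinely_independent (A i)
      & exists u, \bigcap_(i in [set: 'I_n]) Conv (A i) = [set u] /\
          forall i, exists alpha,
            [/\ affine_representation (A i) alpha u,
                forall beta, affine_representation (A i) beta u ->
                  {in A i, beta =1 alpha}
              & {in A i, forall x, alpha x != 0}]]].

End Dipole.

(* Main.v *)
(* A matrix M of total mass 1 is a system of affine coefficients on the points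
   (e_a, e_b), and its row and column sums are the two halves of the barycenter
   of these points.  So a point of Dist(D_n, m) is an n-tuple of convex
   combinations of product-simplex vertices with a common barycenter, and it is
   a vertex exactly when no nonzero tuple of matrices of mass 0 with a common
   barycenter is supported on its support.  Directions concentrated on a single
   edge give affine independence; differences of two distributions give the
   uniqueness of the common point u.  Conversely, uniqueness of u and affine
   independence determine the distribution from its supports, so it cannot be a
   proper convex combination. *)
Require Import Defs.
From mathcomp Require Import all_boot all_order all_algebra finmap.
From mathcomp Require Import boolp classical_sets functions reals.
From mathcomp Require Import lra.

Set Implicit Arguments.
Unset Strict Implicit.
Unset Printing Implicit Defensive.

Import Order.TTheory GRing.Theory Num.Theory.
Local Open Scope classical_set_scope.
Local Open Scope ring_scope.

(** * Matrices as coefficients on product-simplex vertices *)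

Section SimplexVertices.
Variables (R : realType) (m : nat).
Implicit Types (A : {fset 'cV[R]_(m + m)}) (M : 'M[R]_m).

Local Notation sv := (@simplex_vertex R m).

Lemma simplex_vertex_inj a b c d : sv a b = sv c d -> a = c /\ b = d.
Proof.
have delta_inj (i j : 'I_m) : delta_mx i 0 = delta_mx j 0 :> 'cV[R]_m -> i = j.
  move/colP/(_ i); rewrite !mxE !eqxx /= andbT.
  by case: eqP => // _ /eqP; rewrite oner_eq0.
by case/eq_col_mx => /delta_inj-> /delta_inj->.
Qed.

(** By injectivity of [simplex_vertex], every point of [A] comes from exactly one pair of
    indices. *)
Lemma sum_simplex_vertices (W : nmodType) A (F : 'cV[R]_(m + m) -> W) :
  (forall x, x \in A -> exists a b, x = sv a b) ->
  \sum_(x <- A) F x =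
  \sum_a \sum_b (if sv a b \in A then F (sv a b) else 0).
Proof.
move=> hA; rewrite pair_big /= -big_mkcond /=.
transitivity (\sum_(x <- [seq sv ab.1 ab.2 |
    ab <- index_enum ('I_m * 'I_m)%type & sv ab.1 ab.2 \in A]) F x); last first.
  by rewrite big_map big_filter.
apply: perm_big; apply: uniq_perm => [||x].
- exact: fset_uniq.
- rewrite map_inj_uniq ?filter_uniq ?index_enum_uniq // => -[a b] [c d] /=.
  by case/simplex_vertex_inj => -> ->.
apply/idP/mapP => [xA|[[a b]]]; last first.
  by rewrite mem_filter => /andP[/= abA _] ->.
have [a [b xE]] := hA x xA.
by exists (a, b); rewrite // mem_filter /= -xE xA mem_index_enum.
Qed.

Definition mass M : R := \sum_a \sum_b M a b.

Definition barycenter M : 'cV[R]_(m + m) := \sum_a \sum_b M a b *: sv a b.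

(** This turns the conditions of [Dist] on row and column sums into the equality of a single vector
    across edges. *)
Lemma barycenterE M :
  barycenter M = col_mx (\col_a \sum_b M a b) (\col_b \sum_a M a b).
Proof.
apply/colP => k; rewrite -[k]fintype.splitK summxE.
under eq_bigr do rewrite summxE.
case: (fintype.split k) => i /=; rewrite ?col_mxEu ?col_mxEd mxE.
  rewrite (bigD1 i) //= [X in _ + X]big1 ?addr0 => [|a /negPf ai].
    by apply: eq_bigr => b _; rewrite mxE col_mxEu mxE !eqxx mulr1.
  by rewrite big1 // => b _; rewrite mxE col_mxEu mxE eq_sym ai mulr0.
apply: eq_bigr => a _.
rewrite (bigD1 i) //= [X in _ + X]big1 ?addr0 => [|b /negPf bi].
  by rewrite mxE col_mxEd mxE !eqxx mulr1.
by rewrite mxE col_mxEd mxE eq_sym bi mulr0.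
Qed.

Lemma massD M N : mass (M + N) = mass M + mass N.
Proof.
rewrite /mass -big_split; apply: eq_bigr => a _; rewrite -big_split.
by apply: eq_bigr => b _; rewrite mxE.
Qed.

Lemma massZ t M : mass (t *: M) = t * mass M.
Proof.
rewrite /mass mulr_sumr; apply: eq_bigr => a _; rewrite mulr_sumr.
by apply: eq_bigr => b _; rewrite mxE.
Qed.

Lemma barycenterD M N : barycenter (M + N) = barycenter M + barycenter N.
Proof.
rewrite /barycenter -big_split; apply: eq_bigr => a _; rewrite -big_split.
by apply: eq_bigr => b _; rewrite mxE scalerDl.
Qed.

Lemma barycenterZ t M : barycenter (t *: M) = t *: barycenter M.
Proof.
rewrite /barycenter scaler_sumr; apply: eq_bigr => a _; rewrite scaler_sumr.
by apply: eq_bigr => b _; rewrite mxE scalerA.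
Qed.

(** The value 0 off [A] makes weights that agree on [A] give the same matrix. *)
Definition mx_of_weights A (alpha : 'cV[R]_(m + m) -> R) : 'M[R]_m :=
  \matrix_(a, b) if sv a b \in A then alpha (sv a b) else 0.

(* The sum has at most one term, by injectivity of [simplex_vertex]. *)
Definition weights_of_mx M (x : 'cV[R]_(m + m)) : R :=
  \sum_(ab : 'I_m * 'I_m | sv ab.1 ab.2 == x) M ab.1 ab.2.

Lemma weights_of_mxE M a b : weights_of_mx M (sv a b) = M a b.
Proof.
rewrite /weights_of_mx (big_pred1 (a, b)) // => -[c d] /=.
apply/eqP/eqP => [|[-> ->]//].
by case/simplex_vertex_inj => -> ->.
Qed.

Definition mx_supported A M := forall a b, sv a b \notin A -> M a b = 0.

Lemma mx_of_weights_supported A alpha : mx_supported A (mx_of_weights A alpha).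
Proof. by move=> a b /negPf abA; rewrite mxE abA. Qed.

Section WeightSums.
Variable A : {fset 'cV[R]_(m + m)}.
Hypothesis hA : forall x, x \in A -> exists a b, x = sv a b.

Lemma sum_mx_of_weights alpha :
  \sum_(x <- A) alpha x = mass (mx_of_weights A alpha).
Proof.
rewrite sum_simplex_vertices //; apply: eq_bigr => a _.
by apply: eq_bigr => b _; rewrite mxE.
Qed.

Lemma barycenter_mx_of_weights alpha :
  \sum_(x <- A) alpha x *: x = barycenter (mx_of_weights A alpha).
Proof.
rewrite sum_simplex_vertices //; apply: eq_bigr => a _.
by apply: eq_bigr => b _; rewrite mxE; case: ifP; rewrite ?scale0r.
Qed.

Lemma weights_of_mxK M :
  mx_supported A M -> mx_of_weights A (weights_of_mx M) = M.
Proof.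
move=> hM; apply/matrixP => a b; rewrite mxE weights_of_mxE.
by case: ifPn => // /hM.
Qed.

Lemma affine_representation_mx alpha u :
  affine_representation A alpha u <->
  mass (mx_of_weights A alpha) = 1 /\ barycenter (mx_of_weights A alpha) = u.
Proof. by rewrite /affine_representation sum_mx_of_weights barycenter_mx_of_weights. Qed.

Lemma affinely_independent_mx :
  affinely_independent A <->
  forall M, mx_supported A M -> mass M = 0 -> barycenter M = 0 -> M = 0.
Proof.
split=> [indA M hM M0 bM0|indA alpha].
  apply/matrixP => a b; rewrite mxE.
  have [abA|/hM//] := boolP (sv a b \in A).
  rewrite -weights_of_mxE; apply: indA => //.
    by rewrite sum_mx_of_weights weights_of_mxK.
  by rewrite barycenter_mx_of_weights weights_of_mxK.
rewrite sum_mx_of_weights barycenter_mx_of_weights => M0 bM0 x xA.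
have [a [b xE]] := hA xA.
have /matrixP/(_ a b) := indA _ (@mx_of_weights_supported A alpha) M0 bM0.
by rewrite !mxE -xE xA.
Qed.

Lemma Conv_mx u :
  Conv A u <->
  exists M, [/\ mx_supported A M, forall a b, 0 <= M a b, mass M = 1
              & barycenter M = u].
Proof.
split=> [[alpha [alpha0 /affine_representation_mx[M1 bMu]]]|].
  exists (mx_of_weights A alpha); split=> // [|a b].
    exact: mx_of_weights_supported.
  by rewrite mxE; case: ifP => // /alpha0.
move=> [M [hM M0 M1 bMu]]; exists (weights_of_mx M); split.
  by move=> x /hA[a [b ->]]; rewrite weights_of_mxE.
by apply/affine_representation_mx; rewrite weights_of_mxK.
Qed.

(** The difference of the two matrices is an affine dependence on [A]. *)
Lemma mx_supported_uniq M N :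
  affinely_independent A -> mx_supported A M -> mx_supported A N ->
  mass M = mass N -> barycenter M = barycenter N -> M = N.
Proof.
move=> /affinely_independent_mx indA hM hN MN bMN.
apply/subr0_eq; rewrite -scaleN1r; apply: indA => [a b abA||].
- by rewrite !mxE hM // hN // mulr0 addr0.
- by rewrite massD massZ MN mulN1r subrr.
- by rewrite barycenterD barycenterZ bMN scaleN1r subrr.
Qed.

End WeightSums.
End SimplexVertices.

(** * Vertices of the polytope of distributions and their supports *)

Section DipoleVertices.
Variables (R : realType) (n m : nat).
Implicit Types p q d : {ffun 'I_n -> 'M[R]_m}.

Local Notation sv := (@simplex_vertex R m).

Lemma DistP p :
  Dist p <-> [/\ forall i a b, 0 <= p i a b, forall i, mass (p i) = 1
               & forall i j, barycenter (p i) = barycenter (p j)].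
Proof.
split=> [[p0 p1 rowp colp]|[p0 p1 bp]].
  split=> // i j; rewrite !barycenterE.
  by congr col_mx; apply/colP => a; rewrite !mxE.
split=> // i j a; have := bp i j; rewrite !barycenterE.
  by case/eq_col_mx => /colP/(_ a); rewrite !mxE.
by case/eq_col_mx => _ /colP/(_ a); rewrite !mxE.
Qed.

Lemma mem_vertex_supports p i a b :
  (sv a b \in vertex_supports p i) = (p i a b != 0).
Proof.
rewrite ffunE; apply/imfsetP/idP => [[[c d] /= cd]|pab]; last by exists (a, b).
by case/simplex_vertex_inj => -> ->.
Qed.

Lemma vertex_supportsP p i x :
  x \in vertex_supports p i -> exists a b, x = sv a b.
Proof. by rewrite ffunE => /imfsetP[[a b] _ ->]; exists a, b. Qed.

Lemma vertex_supports_supported p q i :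
  mx_supported (vertex_supports p i) (q i) <->
  forall a b, p i a b = 0 -> q i a b = 0.
Proof.
split=> h a b; first by move=> pab; apply: h; rewrite mem_vertex_supports pab eqxx.
by rewrite mem_vertex_supports negbK => /eqP /h.
Qed.

(** Moving along [d] preserves the linear equations of [Dist], and [d] vanishes wherever [p] does.
    So [p] is the midpoint of two distributions [p + e d] and [p - e d] with [e > 0], and
    extremality forces [e d = 0]. *)
Lemma vertex_no_direction p d :
  vertices (@Dist R n m) p ->
  (forall i, mx_supported (vertex_supports p i) (d i)) ->
  (forall i, mass (d i) = 0) ->
  (forall i j, barycenter (d i) = barycenter (d j)) -> d = 0.
Proof.
move=> [/DistP[p0 p1 bp] vp] supd d0 bd.
pose D (x : 'I_n * ('I_m * 'I_m)) := `|d x.1 x.2.1 x.2.2|.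
pose P (x : 'I_n * ('I_m * 'I_m)) := p x.1 x.2.1 x.2.2.
(* This is small enough for both p + e d and p - e d to stay nonnegative. *)
pose e := \big[Num.min/(1 : R)]_(x | P x != 0) (P x / (1 + D x)).
(* The summand 1 avoids division by zero where [d] vanishes, and only makes [e] smaller. *)
have D1 x : 0 < 1 + D x by rewrite ltr_pwDl // normr_ge0.
have e0 : 0 < e.
  apply: (big_ind (fun x : R => 0 < x)) => // [x y x0 y0|x Px]; first by rewrite lt_min x0.
  by rewrite divr_gt0 // lt_neqAle eq_sym Px /=; apply: p0.
have ed i a b : e * `|d i a b| <= p i a b.
  have [pab|pab] := eqVneq (p i a b) 0.
    by rewrite (proj1 (vertex_supports_supported p d i) (supd i)) // normr0 mulr0.
  have : e <= P (i, (a, b)) / (1 + D (i, (a, b))) by apply: bigmin_le_cond.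
  rewrite ler_pdivlMr // /P /D /= => /(le_trans _); apply.
  by rewrite ler_pM2l // lerDr.
have Dist_shift s : `|s| = e -> Dist (p + [ffun i => s *: d i]).
  move=> se; apply/DistP; split=> [i a b|i|i j]; rewrite !ffunE.
  - rewrite !mxE; have := ed i a b; rewrite -se -normrM.
    by rewrite ler_norml => /andP[h _]; lra.
  - by rewrite massD massZ d0 p1 mulr0 addr0.
  - by rewrite !barycenterD !barycenterZ (bp i j) (bd i j).
have half : 0 < (2^-1 : R) < 1 by apply/andP; split; lra.
have [|pe _] := vp _ _ _ (Dist_shift e (gtr0_norm e0))
  (Dist_shift (- e) (etrans (normrN e) (gtr0_norm e0))) half.
  apply/ffunP => i; rewrite !ffunE; apply/matrixP => a b.
  by rewrite !mxE; lra.
apply/ffunP => i; rewrite ffunE; apply/eqP.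
have /ffunP/(_ i) := pe; rewrite !ffunE => /eqP.
by rewrite -subr_eq0 addrC addKr scaler_eq0 gt_eqF.
Qed.

(** Here [q - p] is the excluded direction. This yields both the uniqueness of the common point and
    the injectivity of the correspondence. *)
Lemma vertex_unique p q :
  vertices (@Dist R n m) p -> Dist q ->
  (forall i, mx_supported (vertex_supports p i) (q i)) -> q = p.
Proof.
move=> vp /DistP[_ q1 bq] supq; have [/DistP[_ p1 bp] _] := vp.
apply/subr0_eq/(vertex_no_direction vp) => [i a b ab|i|i j].
- by rewrite !ffunE !mxE supq // (proj2 (vertex_supports_supported p p i)) // subr0.
- by rewrite !ffunE -scaleN1r massD massZ q1 p1 mulN1r subrr.
- by rewrite !ffunE -!scaleN1r !barycenterD !barycenterZ (bq i j) (bp i j).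
Qed.

Lemma vertex_admissible (i0 : 'I_n) p :
  vertices (@Dist R n m) p ->
  @admissible_collections R n m (vertex_supports p).
Proof.
move=> vp; have [/DistP[p0 p1 bp] _] := vp.
have hA i := @vertex_supportsP p i.
have pA i : mx_supported (vertex_supports p i) (p i).
  exact/vertex_supports_supported.
have indA i : affinely_independent (vertex_supports p i).
  apply/(affinely_independent_mx (@hA i)) => M supM M0 bM.
  (* A dependence on edge [i], padded by zero, is a direction, since all its barycenters are 0. *)
  pose d := [ffun j => if j == i then M else 0] : {ffun 'I_n -> 'M[R]_m}.
  have Z0 : mass (0 : 'M[R]_m) = 0 by rewrite -(scale0r 0) massZ mul0r.
  have B0 : barycenter (0 : 'M[R]_m) = 0 by rewrite -(scale0r 0) barycenterZ scale0r.
  have dE j : d j = if j == i then M else 0 by rewrite ffunE.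
  have bd j : barycenter (d j) = 0 by rewrite dE; case: ifP.
  have /ffunP/(_ i) : d = 0; last by rewrite dE eqxx ffunE.
  apply: (vertex_no_direction vp) => [j|j|j k]; rewrite ?bd // dE.
    by case: eqP => [->//|_] a b _; rewrite mxE.
  by case: ifP.
split=> //; exists (barycenter (p i0)); split.
  apply/seteqP; split=> [u Au|_ -> i _]; last first.
    by apply/(Conv_mx (@hA i)); exists (p i); split.
  (* Convex representations of [u], one for each edge, form a distribution supported where [p] is;
     it must be [p], so [u] is the barycenter of [p i0]. *)
  have /choice[q qP] i := proj1 (Conv_mx (@hA i) u) (Au i Logic.I).
  suff <- : [ffun i => q i] = p by rewrite ffunE; have [_ _ _ ->] := qP i0.
  apply: vertex_unique => // [|i]; last by rewrite [X in mx_supported _ X]ffunE; case: (qP i).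
  apply/DistP; split=> [i|i|i j]; rewrite !ffunE.
  - by case: (qP i).
  - by case: (qP i).
  - by have [_ _ _ ->] := qP i; have [_ _ _ ->] := qP j.
move=> i; exists (weights_of_mx (p i)); split.
- by apply/(affine_representation_mx (@hA i)); rewrite weights_of_mxK.
- move=> beta /(affine_representation_mx (@hA i))[b1 bb] x xA.
  have [a [b xE]] := hA i x xA.
  have /matrixP/(_ a b) : mx_of_weights (vertex_supports p i) beta = p i.
    apply: (mx_supported_uniq (@hA i)) => //; first exact: mx_of_weights_supported.
      by rewrite b1 p1.
    by rewrite bb (bp i i0).
  by rewrite mxE -xE xA => ->; rewrite xE weights_of_mxE.
- move=> x xA; have [a [b xE]] := hA i x xA.
  by rewrite xE weights_of_mxE -mem_vertex_supports -xE.
Qed.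

(** The convex representations of [u] on the sets [A i] form the required vertex. *)
Lemma admissible_vertex (A : {ffun 'I_n -> {fset 'cV[R]_(m + m)}}) :
  @admissible_collections R n m A ->
  exists2 p, vertices (@Dist R n m) p & vertex_supports p = A.
Proof.
move=> [hA indA [u [capA repA]]].
have capAu i : Conv (A i) u by have : [set u] u by []; rewrite -capA => /(_ i Logic.I).
have /choice[P PP] i := proj1 (Conv_mx (hA i) u) (capAu i).
pose p := [ffun i => P i].
have Dp : Dist p.
  apply/DistP; split=> [i|i|i j]; rewrite !ffunE.
  - by case: (PP i).
  - by case: (PP i).
  - by have [_ _ _ ->] := PP i; have [_ _ _ ->] := PP j.
(* The barycenter of [q i] lies in every hull, hence is [u]; affine independence then determines
   [q i]. *)
have Dist_uniq q : Dist q -> (forall i, mx_supported (A i) (q i)) -> q = p.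
  move=> /DistP[q0 q1 bq] supq; apply/ffunP => i; rewrite ffunE.
  have [supP _ P1 bP] := PP i.
  apply: (mx_supported_uniq (hA i)) => //; first by rewrite q1 P1.
  rewrite bP; have : (\bigcap_(j in [set: 'I_n]) Conv (A j)) (barycenter (q i)).
    by move=> j _; apply/(Conv_mx (hA j)); exists (q j); split.
  by rewrite capA.
have supp i a b : sv a b \notin A i -> p i a b = 0.
  by rewrite ffunE; case: (PP i) => + _ _ _; apply.
exists p.
  split=> // q r t Dq Dr /andP[t0 t1] pqr.
  have [[q0 _ _ _] [r0 _ _ _]] := (Dq, Dr).
  have t1' : 0 < 1 - t by rewrite subr_gt0.
  (* Where [p] vanishes, so do both nonnegative terms of the convex combination. *)
  have qr0 i a b : sv a b \notin A i -> q i a b = 0 /\ r i a b = 0.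
    move=> /supp; rewrite pqr !ffunE !mxE => /eqP.
    rewrite paddr_eq0 ?(mulr_ge0 (ltW t0)) ?(mulr_ge0 (ltW t1')) // !mulf_eq0 (gt_eqF t0) (gt_eqF t1').
    by case/andP => /eqP-> /eqP->.
  by split; apply: Dist_uniq => // i a b /qr0[].
apply/ffunP => i; apply/fsetP => x.
have [alpha [ralpha ualpha nalpha]] := repA i.
have [supP _ P1 bP] := PP i.
(* The entries of [P i] represent [u], so they agree with [alpha] and are nonzero on all of
   [A i]. *)
have key a b : sv a b \in A i -> p i a b != 0.
  move=> abA; rewrite ffunE -weights_of_mxE ualpha ?nalpha //.
  by apply/(affine_representation_mx (hA i)); rewrite weights_of_mxK.
apply/idP/idP => [xp|xA].
  have [a [b xE]] := vertex_supportsP xp.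
  by move: xp; rewrite xE mem_vertex_supports; apply: contraNT => /supp->.
by have [a [b xE]] := hA i x xA; rewrite xE mem_vertex_supports key -?xE.
Qed.

End DipoleVertices.

Theorem theorem4p23 (R : realType) (n m : nat) (hn : (1 <= n)%N)
    (hm : (2 <= m)%N) :
  set_bij (vertices (@Dist R n m)) (@admissible_collections R n m)
    (@vertex_supports R n m).
Proof.
split=> [p vp|p q /set_mem vp /set_mem vq pq|A /admissible_vertex[p vp <-]].
- exact: (vertex_admissible (Ordinal hn)).
- apply: (vertex_unique vq); first by case: vp.
  by move=> i; rewrite -pq; apply/vertex_supports_supported.
- by exists p.
Qed.
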